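(* Let $2<p<\infty$ and $\frac1p+\frac1q=1$. For any given $\bar x=(\bar t_1,\bar t_2,\dots)\in l_p\setminus\{\theta\}$, the Gâteaux derivative $J'(\bar x)(\cdot):l_p\to l_q$ of the normalized duality mapping $J$ at $\bar x$, represented by $$J'(\bar x)(v)=J(\bar x)\left((p-1)\begin{pmatrix}\lambda_1&0&\cdots\\0&\lambda_2&0\\\vdots&0&\ddots\end{pmatrix}-\frac{(p-2)\sum_{i=1}^\infty\lambda_i|\bar t_i|^p}{\sum_{i=1}^\infty|\bar t_i|^p}\begin{pmatrix}1&0&\cdots\\0&1&0\\\vdots&0&\ddots\end{pmatrix}\right)$$ (where $\{\lambda_n\}_{n=1}^\infty$ is the ratio sequence of $v$ with respect to $\bar x$), is a continuous and linear operator from $l_p$ to $l_q$. Moreover, $J'(\bar x)(\cdot):l_p\to l_q$ is a linear and Lipschitz operator such that $$\|J'(\bar x)(v-u)\|_q\le\left(p-1+(p-2)\|\bar x\|_p^{q}\right)\|v-u\|_p,\quad\text{for any }u,v\in l_p\setminus\{\theta\}\text{ with }u\neq v.$$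
   Context: $(l_p,\|\cdot\|_p)$ and $(l_q,\|\cdot\|_q)$ are the real sequence spaces, $l_p^*=l_q$, $\theta=(0,0,\dots)$. The normalized duality mapping $J:l_p\to l_q$ is given by $J(\theta)=\theta$ and, for $x=(t_1,t_2,\dots)\neq\theta$, $J(x)=\left\{\frac{|t_n|^{p-1}\mathrm{sign}(t_n)}{\|x\|_p^{p-2}}\right\}_{n=1}^\infty$. The Gâteaux derivative of $J$ at $\bar x$ is $J'(\bar x)(v)=\lim_{t\to0}\frac{J(\bar x+tv)-J(\bar x)}{t}$ (limit in $l_q$, $t$ real), with $J'(\bar x)(\theta)=\theta$. For real sequences $\bar x=(\bar t_n)$ and $v=(s_n)$, the ratio sequence $\{\lambda_n\}$ of $v$ with respect to $\bar x$ is defined by $\lambda_n=0$ if $\bar t_n=0$ and $\lambda_n=s_n/\bar t_n$ if $\bar t_n\ne0$. A sequence times an infinite diagonal matrix is computed as a row vector times the matrix (entrywise multiplication by the diagonal entries). *)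

(* Defs.v *)
From HB Require Import structures.
From mathcomp Require Import all_boot all_order all_algebra.
From mathcomp Require Import all_classical all_reals all_analysis.

Set Implicit Arguments.
Unset Strict Implicit.
Unset Printing Implicit Defensive.

Import Order.TTheory GRing.Theory Num.Theory.
Import numFieldNormedType.Exports.

Local Open Scope classical_set_scope.
Local Open Scope ring_scope.

Section lp_space.
Context {R : realType} {p : R} (p1 : (1 <= p%:E)%E).

(* As nonempty sets have nonzero counting measure, no quotient by
   almost-everywhere equality is needed to obtain a normed space. *)
Definition lp : Type := LfunType (@counting nat R) p1.

HB.instance Definition _ := Choice.on lp.
HB.instance Definition _ := GRing.Lmodule.on lp.

Definition lp_norm (x : lp) : R := fine 'N[counting]_p%:E[EFin \o x].

Let p_gt0 : 0 < p.
Proof. by rewrite (lt_le_trans ltr01)// -lee_fin. Qed.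

Lemma lp_norm_series (x : lp) :
  (lp_norm x)%:E = ((\sum_(k <oo) (`|x k| `^ p)%R%:E) `^ p^-1)%E.
Proof. by rewrite finite_norm_fine Lnorm_counting. Qed.

Lemma lp_normD (x y : lp) : lp_norm (x + y) <= lp_norm x + lp_norm y.
Proof. exact: ler_LnormD. Qed.

Lemma lp_normZ (a : R) (x : lp) : lp_norm (a *: x) = `|a| * lp_norm x.
Proof. by apply: EFin_inj; rewrite EFinM !finite_norm_fine -LnormZ. Qed.

Lemma lp_norm_eq0 (x : lp) : lp_norm x = 0 -> x = 0.
Proof.
move=> x0; apply/LfuneqP => k; have := lp_norm_series x; rewrite x0 => /esym.
move=> /poweR_eq0_eq0 S0; have {}S0 : (\sum_(k <oo) (`|x k| `^ p)%R%:E = 0)%E.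
  by apply: S0; apply: nneseries_ge0 => n _ _; rewrite lee_fin powR_ge0.
have xk0 n : (0 <= (`|x n| `^ p)%R%:E)%E by rewrite lee_fin powR_ge0.
have : ((`|x k| `^ p)%R%:E <= 0)%E.
  rewrite -[leRHS]S0 (@nneseriesD1 _ _ k)// leeDl//.
  exact: nneseries_ge0.
rewrite lee_fin => xk; apply/normr0_eq0/(@powR_eq0_eq0 _ _ p)/eqP.
by rewrite eq_le xk powR_ge0.
Qed.

HB.instance Definition _ :=
  Lmodule_isNormed.Build R lp lp_normD lp_normZ lp_norm_eq0.

Lemma lp_normE (x : lp) : `|x| = lp_norm x.
Proof. by []. Qed.

End lp_space.

Section duality_mapping.
Context {R : realType} {p q : R}.
Context (p1 : (1 <= p%:E)%E) (q1 : (1 <= q%:E)%E).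
Context (pq : p^-1 + q^-1 = 1).

Definition duality_seq (x : lp p1) : R^nat := fun n =>
  if x == 0 then 0
  else `|x n| `^ (p - 1) * Num.sg (x n) / `|x| `^ (p - 2).

Let p_gt0 : 0 < p.
Proof. by rewrite (lt_le_trans ltr01)// -lee_fin. Qed.

Let q_gt0 : 0 < q.
Proof. by rewrite (lt_le_trans ltr01)// -lee_fin. Qed.

Let p1q : (p - 1) * q = p.
Proof.
have p0 : p != 0 by rewrite gt_eqF.
have q0 : q != 0 by rewrite gt_eqF.
have -> : p - 1 = p * q^-1.
  by rewrite (_ : q^-1 = 1 - p^-1) ?mulrBr ?mulr1 ?mulfV// -pq addrC addKr.
by rewrite -mulrA mulVf// mulr1.
Qed.

Lemma duality_seq_Lfun (x : lp p1) : duality_seq x \in Lfun counting q%:E.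
Proof.
apply/andP; split; first by rewrite inE.
rewrite inE /= /finite_norm Lnorm_counting//; apply: poweR_lty.
pose c := (`|x| `^ (p - 2))^-1 `^ q.
have c0 : 0 <= c by exact: powR_ge0.
have le_cx n : (`|(EFin \o duality_seq x) n| `^ q <=
                c%:E * (`|x n| `^ p)%R%:E)%E.
  rewrite /= lee_fin /duality_seq; case: ifPn => _.
    by rewrite normr0 powR0 ?gt_eqF// mulr_ge0// powR_ge0.
  have -> : c * `|x n| `^ p = ((`|x| `^ (p - 2))^-1 * `|x n| `^ (p - 1)) `^ q.
    by rewrite powRM ?invr_ge0 ?powR_ge0// -powRrM p1q.
  apply: ge0_ler_powR; rewrite ?nnegrE ?mulr_ge0 ?invr_ge0 ?powR_ge0//.
    exact: ltW.
  rewrite mulrC !normrM ger0_norm ?invr_ge0 ?powR_ge0//.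
  rewrite ler_wpM2l ?invr_ge0 ?powR_ge0// ger0_norm ?powR_ge0//.
  by rewrite ler_piMr ?powR_ge0// normr_sg lern1 leq_b1.
apply: (le_lt_trans (lee_nneseries _ (fun n _ => le_cx n))).
  by move=> n _; rewrite poweR_ge0.
rewrite nneseriesZl; last by move=> n _; rewrite lee_fin powR_ge0.
rewrite lte_mul_pinfty// ?lee_fin//.
apply: (@lty_poweRy _ _ p^-1); first by rewrite invr_eq0 gt_eqF.
by rewrite -lp_norm_series ltry.
Qed.

Definition normalized_duality (x : lp p1) : lp q1 :=
  Lfun_Sub q1 (duality_seq_Lfun x).

End duality_mapping.

Section representation.
Context {R : realType}.

Definition ratio_seq (x v : R^nat) : R^nat := fun n =>
  if x n == 0 then 0 else v n / x n.

Definition inf_diag_mx (d : R^nat) : nat -> nat -> R :=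
  fun i j => if i == j then d i else 0.

(* Row vector times infinite matrix; for a diagonal matrix every series below
   has at most one nonzero term. *)
Definition seq_mulmx (s : R^nat) (M : nat -> nat -> R) : R^nat := fun j =>
  limn (series (fun i => s i * M i j)).

Lemma seq_mul_diag_mx (s d : R^nat) (j : nat) :
  seq_mulmx s (inf_diag_mx d) j = s j * d j.
Proof.
apply: (@cvg_lim _ _ _ \oo) => //; rewrite -(cvg_shiftn j.+1)/=.
rewrite (_ : (fun n => _) = cst (s j * d j)); first exact: cvg_cst.
apply/funext => n; rewrite /series/= (bigD1_seq j)/= ?iota_uniq//; last first.
  by rewrite mem_index_iota addnS ltnS leq_addl.
rewrite /inf_diag_mx eqxx big1 ?addr0// => i /negPf ij.
by rewrite ij mulr0.
Qed.

End representation.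

Section exponents.
Context {R : realType} {p q : R}.

Lemma exponent_ge1 : 2 < p -> (1 <= p%:E)%E.
Proof.
by move=> p2; rewrite lee_fin ltW// (lt_trans _ p2)// ltr1n.
Qed.

Lemma conjugate_exponent_ge1 : 2 < p -> p^-1 + q^-1 = 1 -> (1 <= q%:E)%E.
Proof.
move=> p2 pq; rewrite lee_fin.
have p1 : 1 < p by rewrite (lt_trans _ p2)// ltr1n.
have q1 : q^-1 = 1 - p^-1 by rewrite -pq addrC addKr.
have q0 : 0 < q by rewrite -invr_gt0 q1 subr_gt0 invf_lt1// (lt_trans ltr01).
rewrite -[leRHS]invrK invf_ge1 ?invr_gt0// q1 lerBlDr lerDl invr_ge0.
by rewrite ltW// (lt_trans ltr01).
Qed.

End exponents.

Arguments normalized_duality {R p q p1 q1} pq x.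

(* Main.v *)
Require Import Defs.
From mathcomp Require Import all_boot all_order all_algebra.
From mathcomp Require Import all_classical all_reals all_analysis.
From mathcomp Require Import ring.

Import Order.TTheory GRing.Theory Num.Theory.
Import numFieldNormedType.Exports.

Local Open Scope classical_set_scope.
Local Open Scope ring_scope.

(** Write f t = |t|^(p-1) sgn t and let N x be the sequence f o x, so that
J x = |x|^(2-p) N x.

Differentiability.  The scalar function f is C^1 with derivative
(p-1)|t|^(p-2), and the mean value theorem bounds its difference quotients at
x_n in the direction v_n by (p-1)(|x_n|+|v_n|)^(p-1), whose q-th power
(p-1)^q (|x_n|+|v_n|)^p is summable.  Dominated convergence of series
([tannery], [cvg_lp_dominated]) therefore upgrades coordinatewise convergence
to convergence in l_q, and N has derivative (p-1) D v with
(D v)_n = |x_n|^(p-2) v_n ([power_map_diff_quotient]).  The function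
h |-> |x+hv|^p is the duality pairing of N(x+hv) with x+hv, so its
derivative p <N x, v> follows from the same limit and the continuity of the
pairing; the product rule then gives the derivative of J
([is_derive_normalized_duality]).

Norm estimate.  Estimating the two terms of the derivative separately only
gives the constant (p-1) + (p-2), which is too large for the required bound
when |x| < 1: the derivative of J is invariant under positive scaling of x,
so the constant must remain valid as |x| tends to 0, that is, it must be
at most p-1.  This is possible because J' is the Hessian of |x|^2/2.  With
B(v,u) = <D v, u>, a symmetric nonnegative form, <J'v, u> is |x|^(2-p) times
  A(v,u) = (p-1) B(v,u) - (p-2) B(x,v) B(x,u) / B(x,x).
Cauchy-Schwarz for B yields 0 <= A(u,u) <= (p-1) B(u,u), Hoelder's inequality
yields B(u,u) <= |x|^(p-2) |u|^2, and Cauchy-Schwarz for A then bounds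
|<J'v, u>| by (p-1) |v| |u|.  Since l_q embeds isometrically in the dual
of l_p ([lp_norm_le_pairing]), this says |J'v| <= (p-1) |v|
([norm_duality_derivative]). *)

(** * Signed powers *)

Definition signed_powR {R : realType} (s t : R) : R := `|t| `^ s * Num.sg t.

Lemma norm_signed_powR {R : realType} (s t : R) : s != 0 ->
  `|signed_powR s t| = `|t| `^ s.
Proof.
move=> s0; rewrite /signed_powR normrM normr_sg ger0_norm ?powR_ge0//.
by have [->|_] := eqVneq t 0; rewrite ?mulr1// normr0 powR0// mul0r.
Qed.

Lemma signed_powRN {R : realType} (s t : R) :
  signed_powR s (- t) = - signed_powR s t.
Proof. by rewrite /signed_powR normrN sgrN mulrN. Qed.

Lemma signed_powR_mul {R : realType} (p t : R) : 0 < p ->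
  signed_powR (p - 1) t * t = `|t| `^ p.
Proof.
move=> p0; rewrite /signed_powR -(@mulr_powRB1 _ `|t| p)//.
by rewrite [RHS]mulrC -mulrA -normrEsg.
Qed.

Lemma cvg_norm_powR0 {R : realType} {T : Type} {F : set_system T}
    {FF : Filter F} (f : T -> R) (s : R) : 0 < s ->
  f t @[t --> F] --> 0 -> `|f t| `^ s @[t --> F] --> 0.
Proof.
move=> s0 f0; apply/cvgr0Pnorm_lt => e e0.
have es0 : 0 < e `^ s^-1 by exact: powR_gt0.
move/cvgr0Pnorm_lt : f0 => /(_ _ es0); apply: filterS => t fte.
rewrite ger0_norm ?powR_ge0//.
have -> : e = (e `^ s^-1) `^ s by rewrite -powRrM mulVf ?gt_eqF// powRr1// ltW.
by apply: gt0_ltr_powR => //; rewrite nnegrE ?normr_ge0// ltW.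
Qed.

Lemma is_derive_signed_powR_gt0 {R : realType} (s t : R) : 0 < t ->
  is_derive t 1 (signed_powR s) (s * `|t| `^ (s - 1)).
Proof.
move=> t0; rewrite (gtr0_norm t0).
apply: (@near_eq_is_derive _ _ _ (fun x => x `^ s)); last exact: is_derive1_powR.
near=> x; rewrite /signed_powR.
have x0 : 0 < x by near: x; exact: lt_nbhsr.
by rewrite gtr0_norm// gtr0_sg// mulr1.
Unshelve. all: by end_near. Qed.

(** At the origin the difference quotient is |h|^(s-1), which tends to 0 because
s > 1. *)
Lemma is_derive_signed_powR {R : realType} (s t : R) : 1 < s ->
  is_derive t 1 (signed_powR s) (s * `|t| `^ (s - 1)).
Proof.
move=> s1; have s10 : 0 < s - 1 by rewrite subr_gt0.
have s0 : 0 < s by exact: lt_trans s1.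
case: (ltgtP t 0) => [t0|t0|->].
- rewrite (_ : signed_powR s = - (signed_powR s \o -%R)); last first.
    by apply/funext => x; rewrite fctE/= signed_powRN opprK.
  have D : is_derive (- t) 1 (signed_powR s) (s * `|- t| `^ (s - 1)).
    by apply: is_derive_signed_powR_gt0; rewrite oppr_gt0.
  have E : is_derive t 1 (-%R : R -> R) (- 1).
    exact: is_deriveN.
  have := is_deriveN (is_derive1_comp D E).
  by rewrite mulrN1 opprK normrN.
- exact: is_derive_signed_powR_gt0.
- rewrite normr0 powR0 ?gt_eqF// mulr0.
  suff H : (fun h => h^-1 *: ((signed_powR s \o shift 0) (h *: 1) -
             signed_powR s 0)) @ (0:R)^' --> (0 : R).
    by split; [apply/cvg_ex; exists 0|exact: cvg_lim].
  have H0 : `|h| `^ (s - 1) @[h --> (0:R)^'] --> (0 : R).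
    by apply: cvg_norm_powR0 => //; exact: nbhs_dnbhs.
  apply: cvg_trans H0; apply: near_eq_cvg; near=> h.
  have h0 : h != 0 by near: h; exact: nbhs_dnbhs_neq.
  rewrite /= addr0 /signed_powR sgr0 mulr0 subr0 scaler1 /GRing.scale/=.
  rewrite -(@mulr_powRB1 _ `|h| s)// mulrAC (mulrC `|h|) mulr_sg_norm.
  by rewrite mulrA mulVf// mul1r.
Unshelve. all: by end_near. Qed.

(** Mean value theorem: every point between a and a + d has absolute value at
most |a| + |d|. *)
Lemma signed_powR_dist {R : realType} (s a d : R) : 1 < s ->
  `|signed_powR s (a + d) - signed_powR s a|
    <= s * (`|a| + `|d|) `^ (s - 1) * `|d|.
Proof.
move=> s1; have s0 : 0 < s by exact: lt_trans s1.
have dP (x : R) : is_derive x 1 (signed_powR s) (s * `|x| `^ (s - 1)).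
  exact: is_derive_signed_powR.
have cP (x y : R) : {within `[x, y], continuous (signed_powR s)}.
  by apply: derivable_within_continuous => z _; exact: ex_derive.
have bound (x y : R) c : x <= y -> `|x| <= `|a| + `|d| -> `|y| <= `|a| + `|d| ->
   c \in `[x, y]%R -> s * `|c| `^ (s - 1) <= s * (`|a| + `|d|) `^ (s - 1).
  move=> xy xad yad; rewrite in_itv/= => /andP[xc cy].
  apply: ler_wpM2l; first exact: ltW.
  apply: ge0_ler_powR; rewrite ?nnegrE//; [by rewrite subr_ge0 ltW|].
  rewrite ler_norml; move: xad yad; rewrite !ler_norml => /andP[xa _] /andP[_ ya].
  by rewrite (le_trans xa xc) (le_trans cy ya).
have [d0|d0] := leP 0 d.
- have ad : a <= a + d by rewrite lerDl.
  have [c cad ->] := MVT_segment ad (fun x _ => dP x) (cP _ _).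
  rewrite (addrC a) addrK normrM ler_wpM2r//.
  rewrite ger0_norm ?mulr_ge0 ?powR_ge0// ?(ltW s0)//.
  by apply: (bound _ _ _ ad _ _ cad); rewrite ?lerDl// ler_normD.
- have ad : a + d <= a by rewrite gerDl ltW.
  have [c cad] := MVT_segment ad (fun x _ => dP x) (cP _ _).
  rewrite distrC => ->.
  rewrite opprD addrA subrr add0r normrM normrN ler_wpM2r//.
  rewrite ger0_norm ?mulr_ge0 ?powR_ge0// ?(ltW s0)//.
  by apply: (bound _ _ _ ad _ _ cad); rewrite ?lerDl// ler_normD.
Qed.

(** * Real series *)

Lemma nneseries_lim {R : realType} (u : R^nat) : cvgn (series u) ->
  (\sum_(k <oo) (u k)%:E)%E = (limn (series u))%:E.
Proof.
move=> cu; rewrite -EFin_lim//; congr (limn _).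
by apply/funext => n /=; rewrite sumEFin.
Qed.

Lemma lim_series_ge0 {R : realType} (u : R^nat) : (forall n, 0 <= u n) ->
  cvgn (series u) -> 0 <= limn (series u).
Proof.
by move=> u0 cu; apply: limr_ge => //; apply: nearW => n; apply: sumr_ge0.
Qed.

(** Hoelder's inequality for the counting measure, with the finiteness of the
norms phrased as convergence of real series, since the pairing below is a limit
of real partial sums. *)
Lemma hoelder_series {R : realType} (p q : R) (f g : R^nat) :
  0 < p -> 0 < q -> p^-1 + q^-1 = 1 ->
  cvgn (series (fun n => `|f n| `^ p)) -> cvgn (series (fun n => `|g n| `^ q)) ->
  cvgn (series (fun n => `|f n * g n|)) /\
  limn (series (fun n => `|f n * g n|)) <=
    limn (series (fun n => `|f n| `^ p)) `^ p^-1 *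
    limn (series (fun n => `|g n| `^ q)) `^ q^-1.
Proof.
move=> p0 q0 pq cf cg.
have := @hoelder _ _ R (@counting nat R) f g p q.
rewrite !Lnorm_counting// /= invr1.
move=> /(_ _ _ p0 q0 pq) H.
have {H} : (\sum_(k <oo) (`|f k * g k|)%:E <=
    (limn (series (fun n => `|f n| `^ p)) `^ p^-1 *
    limn (series (fun n => `|g n| `^ q)) `^ q^-1)%:E)%E.
  have E (a b : R) : ((a `^ p^-1 * b `^ q^-1)%:E =
    a%:E `^ p^-1 * b%:E `^ q^-1)%E by rewrite !poweR_EFin EFinM.
  rewrite E -(nneseries_lim _ cf) -(nneseries_lim _ cg).
  apply: le_trans (H _ _) => //.
  rewrite poweRe1; last by apply: nneseries_ge0 => n _ _; rewrite lee_fin powR_ge0.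
  by apply: lee_nneseries => // n _; rewrite /= powRr1.
move=> H.
have cfg : cvgn (series (fun n => `|f n * g n|)).
  by apply: nnseries_is_cvg => //; apply: le_lt_trans H _; rewrite ltry.
by split => //; rewrite -lee_fin -(nneseries_lim _ cfg).
Qed.

(** Dominated convergence for series along an arbitrary filter: beyond some rank
N the tail is controlled by the tail of the majorant series, and the first N
terms tend to 0. *)
Lemma tannery {R : realType} {T : Type} {F : set_system T} {FF : Filter F}
    (f : T -> R^nat) (b : R^nat) :
  cvgn (series b) ->
  (\forall t \near F, forall n, 0 <= f t n <= b n) ->
  (forall n, f t n @[t --> F] --> 0) ->
  limn (series (f t)) @[t --> F] --> 0.
Proof.
move=> cb fb f0; apply/cvgr0Pnorm_lt => e e0.
have e20 : 0 < e / 2 by rewrite divr_gt0.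
(* N is the rank beyond which the majorant series has tail less than e / 2 *)
have [N _ HN] := (cvgrPdist_lt _ _).1 cb _ e20.
have SN : series (f t) N @[t --> F] --> (0 : R).
  rewrite [X in _ --> X](_ : _ = \sum_(0 <= k < N) (0 : R)); last by rewrite big1.
  by apply: cvg_big => [|k _]; [exact: add_continuous|exact: f0].
move/cvgr0Pnorm_lt : SN => /(_ _ e20) SN.
near=> t.
have fbt n : 0 <= f t n <= b n by move: n; near: t.
have ft0 n : 0 <= f t n by case/andP: (fbt n).
have ftb n : f t n <= b n by case/andP: (fbt n).
have b0 n : 0 <= b n by exact: le_trans (ft0 n) (ftb n).
have cf : cvgn (series (f t)) by exact: series_le_cvg cb.
rewrite ger0_norm ?lim_series_ge0//.
have SNt : series (f t) N < e / 2.
  rewrite -[ltLHS]ger0_norm; last exact: sumr_ge0.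
  by near: t.
have BN : limn (series b) - series b N < e / 2.
  by apply: le_lt_trans (HN N _) => //=; rewrite ler_norm.
rewrite (splitr e) (le_lt_trans _ (ltrD SNt BN))//.
apply: limr_le => //; near=> n.
have Nn : (N <= n)%N by near: n; exact: nbhs_infty_ge.
rewrite -lerBlDl sub_series_geq// (le_trans (ler_sum _ (fun k _ => ftb k)))//.
rewrite -sub_series_geq// lerD2r nondecreasing_cvgn_le//.
by apply: nondecreasing_series.
Unshelve. all: by end_near. Qed.

(** * Norm and convergence in l_p *)

Section lp_basics.
Context {R : realType} {p : R} (p1 : (1 <= p%:E)%E).

Let p_gt0 : 0 < p.
Proof. by rewrite (lt_le_trans ltr01)// -lee_fin. Qed.

Lemma lpP (x y : lp p1) : x =1 y -> x = y.
Proof. by move=> xy; exact/LfuneqP. Qed.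

Lemma lpD (x y : lp p1) n : (x + y) n = x n + y n.
Proof. by []. Qed.

Lemma lpZ a (x : lp p1) n : (a *: x) n = a * x n.
Proof. by []. Qed.

Lemma lpN (x : lp p1) n : (- x) n = - x n.
Proof. by []. Qed.

Lemma lp0 n : (0 : lp p1) n = 0.
Proof. by []. Qed.

Lemma is_cvg_series_lp (x : lp p1) : cvgn (series (fun n => `|x n| `^ p)).
Proof.
apply: nnseries_is_cvg => [i|]; first exact: powR_ge0.
apply: (@lty_poweRy _ _ p^-1); first by rewrite invr_eq0 gt_eqF.
by rewrite -lp_norm_series ltry.
Qed.

Lemma lp_normE_series (x : lp p1) :
  `|x| = limn (series (fun n => `|x n| `^ p)) `^ p^-1.
Proof.
apply: EFin_inj; rewrite lp_normE lp_norm_series.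
by rewrite (nneseries_lim _ (is_cvg_series_lp x)).
Qed.

Lemma lp_norm_powR (x : lp p1) :
  `|x| `^ p = limn (series (fun n => `|x n| `^ p)).
Proof.
rewrite lp_normE_series -powRrM mulVf ?gt_eqF// powRr1//.
by apply: lim_series_ge0 => [n|]; [exact: powR_ge0|exact: is_cvg_series_lp].
Qed.

Lemma mem_Lfun_counting (u : R^nat) :
  cvgn (series (fun n => `|u n| `^ p)) -> u \in Lfun counting p%:E.
Proof.
move=> cu; apply/andP; split; first by rewrite inE.
rewrite inE /= /finite_norm Lnorm_counting//; apply: poweR_lty.
rewrite [X in (X < _)%E](nneseries_lim _ cu).
by rewrite ltry.
Qed.

Definition lp_of (u : R^nat) (cu : cvgn (series (fun n => `|u n| `^ p))) : lp p1 :=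
  Lfun_Sub p1 (mem_Lfun_counting _ cu).

(** Dominated convergence in l_p: the p-th powers of the coordinates of
g t - l are dominated by (2 b)^p. *)
Lemma cvg_lp_dominated {T : Type} {F : set_system T} {FF : Filter F}
    (g : T -> lp p1) (l : lp p1) (b : R^nat) :
  cvgn (series (fun n => (2 * b n) `^ p)) ->
  (forall n, `|l n| <= b n) ->
  (\forall t \near F, forall n, `|g t n| <= b n) ->
  (forall n, g t n @[t --> F] --> l n) ->
  g t @[t --> F] --> l.
Proof.
move=> cb lb gb gl; apply/subr_cvg0/norm_cvg0P.
rewrite (_ : (fun _ => _) =
  fun t => `|limn (series (fun n => `|(g t - l) n| `^ p))| `^ p^-1); last first.
  apply/funext => t; rewrite lp_normE_series ger0_norm//.
  by apply: lim_series_ge0 => [n|]; [exact: powR_ge0|exact: is_cvg_series_lp].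
apply: cvg_norm_powR0; first by rewrite invr_gt0.
apply: tannery cb _ _ => [|n].
  apply: filterS gb => t gbt n; rewrite powR_ge0/=.
  have gln : `|(g t - l) n| <= 2 * b n.
    by rewrite lpD lpN (le_trans (ler_normB _ _))// mulr2n mulrDl mul1r lerD.
  apply: ge0_ler_powR => //; first exact: ltW.
  by rewrite nnegrE (le_trans _ gln).
apply: cvg_norm_powR0 => //.
by apply/subr_cvg0; exact: gl.
Qed.

End lp_basics.

(** * The pairing of l_q with l_p *)

Definition pairing {R : realType} (z u : R^nat) : R :=
  limn (series (fun n => z n * u n)).

Lemma pairingC {R : realType} (z u : R^nat) : pairing z u = pairing u z.
Proof.
by rewrite /pairing; congr (limn (series _)); apply/funext => n; rewrite mulrC.
Qed.

Section pairing.
Context {R : realType} {p q : R} {p1 : (1 <= p%:E)%E} {q1 : (1 <= q%:E)%E}.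
Context (pq : p^-1 + q^-1 = 1).

Let p_gt0 : 0 < p.
Proof. by rewrite (lt_le_trans ltr01)// -lee_fin. Qed.

Let q_gt0 : 0 < q.
Proof. by rewrite (lt_le_trans ltr01)// -lee_fin. Qed.

Let qp : q^-1 + p^-1 = 1. Proof. by rewrite addrC. Qed.

Lemma conjugate_exponentM : (p - 1) * q = p.
Proof.
have p0 : p != 0 by rewrite gt_eqF.
have q0 : q != 0 by rewrite gt_eqF.
have -> : p - 1 = p * q^-1.
  by rewrite (_ : q^-1 = 1 - p^-1) ?mulrBr ?mulr1 ?mulfV// -pq addrC addKr.
by rewrite -mulrA mulVf// mulr1.
Qed.

Lemma conjugate_exponent_subr1_gt0 : 0 < p - 1.
Proof. by rewrite -(pmulr_lgt0 _ q_gt0) conjugate_exponentM. Qed.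

Lemma is_cvg_pairing (z : lp q1) (u : lp p1) :
  cvgn (series (fun n => z n * u n)).
Proof.
by have [/normed_cvg ? _] := hoelder_series _ _ _ _ q_gt0 p_gt0 qp
  (is_cvg_series_lp q1 z) (is_cvg_series_lp p1 u).
Qed.

Lemma pairing_le (z : lp q1) (u : lp p1) : `|pairing z u| <= `|z| * `|u|.
Proof.
have [c le] := hoelder_series _ _ _ _ q_gt0 p_gt0 qp
  (is_cvg_series_lp q1 z) (is_cvg_series_lp p1 u).
rewrite !lp_normE_series; apply: le_trans le.
exact: lim_series_norm.
Qed.

Lemma pairingDl (z w : lp q1) (u : lp p1) :
  pairing (z + w) u = pairing z u + pairing w u.
Proof.
rewrite /pairing -lim_seriesD; [|exact: is_cvg_pairing..].
by congr (limn (series _)); apply/funext => n; rewrite lpD mulrDl.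
Qed.

Lemma pairingZl a (z : lp q1) (u : lp p1) : pairing (a *: z) u = a * pairing z u.
Proof.
rewrite /pairing -[RHS]/(a *: _) -lim_seriesZ; last exact: is_cvg_pairing.
by congr (limn (series _)); apply/funext => n; rewrite lpZ -mulrA.
Qed.

Lemma pairingDr (z : lp q1) (u v : lp p1) :
  pairing z (u + v) = pairing z u + pairing z v.
Proof.
rewrite /pairing -lim_seriesD; [|exact: is_cvg_pairing..].
by congr (limn (series _)); apply/funext => n; rewrite lpD mulrDr.
Qed.

Lemma pairingZr a (z : lp q1) (u : lp p1) : pairing z (a *: u) = a * pairing z u.
Proof.
rewrite /pairing -[RHS]/(a *: _) -lim_seriesZ; last exact: is_cvg_pairing.
by congr (limn (series _)); apply/funext => n; rewrite lpZ mulrCA.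
Qed.

Lemma pairingBl (z w : lp q1) (u : lp p1) :
  pairing (z - w) u = pairing z u - pairing w u.
Proof. by rewrite -scaleN1r pairingDl pairingZl mulN1r. Qed.

(** Joint continuity, from
<g, h> - <z, u> = <g - z, h> + <z, h - u>. *)
Lemma cvg_pairing {T : Type} {F : set_system T} {FF : Filter F}
    (g : T -> lp q1) (z : lp q1) (h : T -> lp p1) (u : lp p1) :
  g t @[t --> F] --> z -> h t @[t --> F] --> u ->
  pairing (g t) (h t) @[t --> F] --> pairing z u.
Proof.
move=> gz hu.
have H : (pairing (g t - z) (h t) + pairing z (h t - u)) @[t --> F] --> (0 : R).
  rewrite -[X in _ --> X]addr0; apply: cvgD.
    apply/norm_cvg0P.
    apply: (@squeeze_cvgr _ _ _ _ (fun=> 0) (fun t => `|g t - z| * `|h t|)).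
    - by near=> t; rewrite normr_ge0 pairing_le.
    - exact: cvg_cst.
    - rewrite -(mul0r `|u|); apply: cvgM; last exact: cvg_norm.
      by rewrite -(@normr0 _ (lp q1)); apply: cvg_norm; apply/subr_cvg0.
  apply/norm_cvg0P; apply: (@squeeze_cvgr _ _ _ _ (fun=> 0)
    (fun t => `|z| * `|h t - u|)).
  - by near=> t; rewrite normr_ge0 pairing_le.
  - exact: cvg_cst.
  - rewrite -(mulr0 `|z|); apply: cvgM; first exact: cvg_cst.
    by rewrite -(@normr0 _ (lp p1)); apply: cvg_norm; apply/subr_cvg0.
apply/subr_cvg0; apply: cvg_trans H; apply: near_eq_cvg; near=> t.
by rewrite pairingBl -(scaleN1r u) pairingDr pairingZr mulN1r addrA addrNK.
Unshelve. all: by end_near. Qed.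

Lemma normalized_dualityE (x : lp p1) n :
  (normalized_duality pq x : lp q1) n =
    signed_powR (p - 1) (x n) / `|x| `^ (p - 2).
Proof.
rewrite /normalized_duality/= /duality_seq; case: ifPn => // /eqP ->.
by rewrite /signed_powR sgr0 mulr0 mul0r.
Qed.

Lemma pairing_duality (x : lp p1) :
  pairing (normalized_duality pq x : lp q1) x = `|x| ^+ 2.
Proof.
have [->|x0] := eqVneq x 0.
  by rewrite -(scale0r (0 : lp p1)) pairingZr mul0r normrZ normr0 mul0r expr0n.
rewrite /pairing (_ : (fun _ => _) =
    (`|x| `^ (p - 2))^-1 *: (fun n => `|x n| `^ p)); last first.
  by apply/funext => n; rewrite normalized_dualityE mulrAC signed_powR_mul// mulrC.
rewrite lim_seriesZ; last exact: is_cvg_series_lp.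
rewrite -lp_norm_powR /GRing.scale/= -powRN -powRD; last first.
  by rewrite normr_eq0 x0 implybT.
by rewrite opprB subrK powR_mulrn.
Qed.

Lemma norm_duality (x : lp p1) : `|normalized_duality pq x : lp q1| = `|x|.
Proof.
have [->|x0] := eqVneq x 0.
  rewrite normr0; apply/eqP; rewrite normr_eq0; apply/eqP/lpP => n.
  by rewrite normalized_dualityE lp0 /signed_powR sgr0 mulr0 mul0r.
have nx : `|x| != 0 by rewrite normr_eq0.
rewrite lp_normE_series (_ : (fun _ => _) =
    (`|x| `^ (p - 2))^-1 `^ q *: (fun n => `|x n| `^ p)); last first.
  apply/funext => n; rewrite normalized_dualityE normrM.
  rewrite norm_signed_powR ?gt_eqF ?conjugate_exponent_subr1_gt0//.
  rewrite normfV (ger0_norm (powR_ge0 _ _)) powRM ?invr_ge0 ?powR_ge0//.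
  by rewrite -powRrM conjugate_exponentM mulrC.
rewrite lim_seriesZ; last exact: is_cvg_series_lp.
rewrite -lp_norm_powR /GRing.scale/= powRM ?powR_ge0//.
rewrite -powRrM mulfV ?gt_eqF// powRr1 ?invr_ge0 ?powR_ge0// -powRrM.
have -> : p / q = p - 1 by rewrite -{1}conjugate_exponentM mulfK// gt_eqF.
rewrite -powRN -powRD ?nx ?implybT//.
by rewrite opprB addrA subrK (_ : 2 - 1 = 1) ?powRr1// -(natrB _ (isT : (1 <= 2)%N)).
Qed.

End pairing.

(** The supremum defining the dual norm is attained at the image of z under the
duality mapping of l_q, which has the norm of z and pairs with z to |z|^2. *)
Lemma lp_norm_le_pairing {R : realType} {p q : R} {p1 : (1 <= p%:E)%E}
    {q1 : (1 <= q%:E)%E} (pq : p^-1 + q^-1 = 1) (z : lp q1) (C : R) :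
  0 <= C -> (forall u : lp p1, `|pairing z u| <= C * `|u|) -> `|z| <= C.
Proof.
move=> C0 zC; have [->|z0] := eqVneq z 0; first by rewrite normr0.
have qp : q^-1 + p^-1 = 1 by rewrite addrC.
have := zC (normalized_duality qp z).
rewrite norm_duality// pairingC pairing_duality// ger0_norm ?exprn_ge0//.
by rewrite expr2 ler_pM2r// normr_gt0.
Qed.

(** * Derivative of the duality mapping *)

Lemma scaler_diff_quotient {R : comPzRingType} {V : lmodType R} (k a b : R)
    (y z : V) :
  a *: (k *: (y - z)) + (k * (a - b)) *: z = k *: (a *: y - b *: z).
Proof.
rewrite -scalerA scalerA (mulrC a) -scalerA -scalerDr.
by rewrite scalerBr scalerBl addrA subrK.
Qed.

(** Expand the nonnegative quadratic t |-> B (t u + v) (t u + v) and choose t to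
be its minimiser; when B u u = 0 the quadratic is affine, so it is nonnegative
everywhere only if B u v = 0. *)
Lemma cauchy_schwarz {R : realFieldType} {V : lmodType R} (B : V -> V -> R) :
  (forall a u v w, B (a *: u + v) w = a * B u w + B v w) ->
  (forall u v, B u v = B v u) -> (forall u, 0 <= B u u) ->
  forall u v, B u v ^+ 2 <= B u u * B v v.
Proof.
move=> Bl BC B0 u v.
have quad t : 0 <= t ^+ 2 * B u u + 2 * t * B u v + B v v.
  have := B0 (t *: u + v).
  rewrite Bl (BC u (_ + _)) (BC v (_ + _)) !Bl (BC v u).
  by congr (0 <= _); ring.
have [Bu|Bu] := eqVneq (B u u) 0.
  rewrite Bu mul0r; have [->|Buv] := eqVneq (B u v) 0; first by rewrite expr0n.
  (* with B u u = 0 this t gives the quadratic the value -1 *)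
  have := quad (- (B v v + 1) / (2 * B u v)).
  rewrite Bu mulr0 add0r (_ : _ + B v v = - 1); last by field.
  by rewrite oppr_ge0 ler10.
have Bu0 : 0 < B u u by rewrite lt_neqAle eq_sym Bu B0.
have := quad (- B u v / B u u).
rewrite (_ : _ + _ = (B u u * B v v - B u v ^+ 2) / B u u); last by field.
by rewrite pmulr_lge0 ?invr_gt0// subr_ge0.
Qed.

Section derivative.
Context {R : realType} {p q : R} {p1 : (1 <= p%:E)%E} {q1 : (1 <= q%:E)%E}.
Context (p2 : 2 < p) (pq : p^-1 + q^-1 = 1).
Implicit Types x v w u : lp p1.

Let p_gt0 : 0 < p.
Proof. by rewrite (lt_le_trans ltr01)// -lee_fin. Qed.

Let q_gt0 : 0 < q.
Proof. by rewrite (lt_le_trans ltr01)// -lee_fin. Qed.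

Let p12 : p - 1 - 1 = p - 2. Proof. by rewrite -addrA -opprD. Qed.

Let p2_gt0 : 0 < p - 2. Proof. by rewrite subr_gt0. Qed.

Let p1_gt1 : 1 < p - 1. Proof. by rewrite -subr_gt0 p12. Qed.

Let p1_gt0 : 0 < p - 1. Proof. exact: lt_trans p1_gt1. Qed.

(** The sequence |x_n|^(p-1) sgn x_n, obtained by undoing the normalization of
the duality mapping; this gives its membership in l_q for free. *)
Definition power_map x : lp q1 := `|x| `^ (p - 2) *: normalized_duality pq x.

Lemma power_mapE x n : power_map x n = signed_powR (p - 1) (x n).
Proof.
rewrite /power_map lpZ normalized_dualityE mulrC.
have [->|x0] := eqVneq x 0; first by rewrite lp0 /signed_powR sgr0 mulr0 !mul0r.
by rewrite divfK// gt_eqF// powR_gt0// normr_gt0.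
Qed.

Lemma normalized_duality_power_map x :
  normalized_duality pq x = `|x| `^ (2 - p) *: power_map x.
Proof.
apply: lpP => n; rewrite normalized_dualityE lpZ power_mapE.
by rewrite -(opprB p 2) powRN mulrC.
Qed.

(** Bound for the absolute values of the coordinates of x + h v, |h| <= 1. *)
Definition majorant x v n : R := `|x n| + `|v n|.

Lemma majorant_ge0 x v n : 0 <= majorant x v n.
Proof. exact: addr_ge0. Qed.

Lemma is_cvg_series_majorant x v : cvgn (series (fun n => majorant x v n `^ p)).
Proof.
have ca u : cvgn (series (fun n => `|(fun k => `|(u : lp p1) k|) n| `^ p)).
  by under [fun n => _]eq_fun do rewrite normr_id; exact: is_cvg_series_lp.
have := is_cvg_series_lp p1 (lp_of p1 _ (ca x) + lp_of p1 _ (ca v)).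
rewrite (_ : (fun _ => _) = (fun n => majorant x v n `^ p))//.
by apply/funext => n; rewrite lpD ger0_norm// majorant_ge0.
Qed.

Lemma weight_le_majorant x v n :
  `|x n| `^ (p - 2) * `|v n| <= majorant x v n `^ (p - 1).
Proof.
rewrite -(@mulr_powRB1 _ _ (p - 1)) ?majorant_ge0// p12 mulrC.
apply: ler_pM => //; rewrite ?powR_ge0//; first by rewrite lerDr.
by apply: ge0_ler_powR; rewrite ?nnegrE ?majorant_ge0 ?lerDl// ltW.
Qed.

Lemma majorant_powR x v n : (majorant x v n `^ (p - 1)) `^ q = majorant x v n `^ p.
Proof. by rewrite -powRrM conjugate_exponentM. Qed.

Lemma is_cvg_weight x v :
  cvgn (series (fun n => `| `|x n| `^ (p - 2) * v n| `^ q)).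
Proof.
apply: series_le_cvg (is_cvg_series_majorant x v) => n; rewrite ?powR_ge0//.
rewrite -majorant_powR; apply: ge0_ler_powR; rewrite ?nnegrE ?powR_ge0 ?(ltW q_gt0)//.
by rewrite normrM (ger0_norm (powR_ge0 _ _)) weight_le_majorant.
Qed.

(** Up to the factor p - 1, the derivative at x of [power_map]. *)
Definition weight x v : lp q1 := lp_of q1 _ (is_cvg_weight x v).

Lemma weightE x v n : weight x v n = `|x n| `^ (p - 2) * v n.
Proof. by []. Qed.

Lemma weight_linear x a v w : weight x (a *: v + w) = a *: weight x v + weight x w.
Proof. by apply: lpP => n; rewrite !(lpD, lpZ, weightE) mulrDr mulrCA. Qed.

Lemma weight_self x : weight x x = power_map x.
Proof.
apply: lpP => n; rewrite weightE power_mapE /signed_powR.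
rewrite -(@mulr_powRB1 _ _ (p - 1))// p12 mulrAC.
by rewrite [X in _ = X * _]mulrC mulr_sg_norm mulrC.
Qed.

Lemma pairing_weightC x v w : pairing (weight x v) w = pairing (weight x w) v.
Proof.
rewrite /pairing; congr (limn (series _)); apply/funext => n.
by rewrite !weightE mulrAC.
Qed.

Lemma power_map_norm x : pairing (power_map x) x = `|x| `^ p.
Proof.
rewrite /power_map pairingZl// pairing_duality//.
have [->|x0] := eqVneq x 0; first by rewrite normr0 !powR0 ?gt_eqF// mul0r.
by rewrite -powR_mulrn// -powRD ?subrK// normr_eq0 x0 implybT.
Qed.

(** Chain rule for h |-> h b + a at h = 0. *)
Lemma signed_powR_diff_quotient (a b : R) :
  h^-1 * (signed_powR (p - 1) (h * b + a) - signed_powR (p - 1) a)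
    @[h --> (0:R)^'] --> (p - 1) * (`|a| `^ (p - 2) * b).
Proof.
have D : is_derive (0 * b + a) 1 (signed_powR (p - 1))
    ((p - 1) * `|a| `^ (p - 2)).
  by rewrite mul0r add0r -p12; exact: is_derive_signed_powR.
have E : is_derive (0 : R) 1 (fun h => h * b + a) b.
  rewrite (_ : (fun h => _) = (b \*: id) + cst a); last first.
    by apply/funext => h; rewrite fctE/= mulrC.
  have := is_deriveD (is_deriveZ b (is_derive_id (0:R) 1)) (is_derive_cst a (0:R) 1).
  by rewrite addr0 /GRing.scale/= mulr1.
have [dv val] := is_derive1_comp (g := fun h => h * b + a) (x := 0) D E.
rewrite mulrA -val; apply: cvg_trans dv; apply: near_eq_cvg.
by apply: nearW => h; rewrite /= /GRing.scale/= mulr1 addr0 mul0r add0r.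
Qed.

(** Coordinatewise convergence is the scalar case; by the mean value theorem the
difference quotients for |h| <= 1 are dominated by (p-1) [majorant]^(p-1), and
(p-1) q = p makes the q-th powers of the dominating sequence summable. *)
Lemma power_map_diff_quotient x v :
  h^-1 *: (power_map (h *: v + x) - power_map x) @[h --> (0:R)^']
    --> (p - 1) *: weight x v.
Proof.
apply: (@cvg_lp_dominated _ _ _ _ _ _ _ _ (fun n => (p - 1) * majorant x v n `^ (p - 1))).
- rewrite (_ : (fun n => _) =
      ((2 * (p - 1)) `^ q) *: (fun n => majorant x v n `^ p)).
    by apply: is_cvg_seriesZ; exact: is_cvg_series_majorant.
  apply/funext => n; rewrite mulrA powRM ?powR_ge0//; last first.
    by rewrite mulr_ge0// ltW.
  by rewrite majorant_powR.
- move=> n; rewrite lpZ weightE !normrM (gtr0_norm p1_gt0) (ger0_norm (powR_ge0 _ _)).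
  by rewrite ler_wpM2l ?weight_le_majorant// ltW.
- near=> h => n.
  have h0 : h != 0 by near: h; exact: nbhs_dnbhs_neq.
  have h1 : `|h| <= 1.
    by near: h; apply: nbhs_dnbhs; exact: (@nbhs0_le _ R^o).
  rewrite lpZ lpD lpN !power_mapE lpD lpZ (addrC (h * v n)).
  rewrite normrM normfV ler_pdivrMl ?normr_gt0//.
  apply: (le_trans (signed_powR_dist _ _ _ p1_gt1)); rewrite p12.
  rewrite [leRHS]mulrCA -mulrA ler_wpM2l ?(ltW p1_gt0)//.
  rewrite {2}normrM mulrCA ler_wpM2l//.
  rewrite -(@mulr_powRB1 _ _ (p - 1)) ?majorant_ge0// p12 mulrC.
  apply: ler_pM; rewrite ?powR_ge0 ?lerDr//.
  apply: ge0_ler_powR; rewrite ?nnegrE ?(ltW p2_gt0) ?majorant_ge0//.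
  by rewrite lerD2l normrM ler_piMl.
- move=> n; rewrite lpZ weightE; apply: cvg_trans (signed_powR_diff_quotient _ _).
  apply: near_eq_cvg; apply: nearW => h.
  by rewrite lpZ lpD lpN !power_mapE lpD lpZ.
Unshelve. all: by end_near. Qed.

Lemma pairing_weight_self x v : pairing (weight x v) x = pairing (power_map x) v.
Proof. by rewrite pairing_weightC weight_self. Qed.

Lemma shift_cvg x v : (h *: v + x) @[h --> (0:R)^'] --> x.
Proof.
rewrite -[X in _ --> X]add0r -[X in _ --> X + _](scale0r v).
apply: cvgD; last exact: cvg_cst.
by apply: cvgZr_tmp; exact: nbhs_dnbhs.
Qed.

(** |y|^p = <N y, y> for N = [power_map], so that
|x+hv|^p - |x|^p = <N(x+hv) - N x, x+hv> + h <N x, v>.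
The first term contributes (p-1) <D v, x> = (p-1) <N x, v>. *)
Lemma is_derive_norm_powR x v :
  is_derive (0 : R) 1 (fun h => `|h *: v + x| `^ p) (p * pairing (power_map x) v).
Proof.
have H : (fun h => h^-1 *: (((fun h => `|h *: v + x| `^ p) \o shift 0) (h *: 1)
    - `|0 *: v + x| `^ p)) @ (0:R)^' --> p * pairing (power_map x) v.
  rewrite scale0r add0r.
  have -> : p * pairing (power_map x) v =
      pairing ((p - 1) *: weight x v : lp q1) x + pairing (power_map x) v.
    by rewrite (pairingZl pq (p - 1)) pairing_weight_self mulrBl mul1r subrK.
  have := cvgD (cvg_pairing pq _ _ _ _ (power_map_diff_quotient x v) (shift_cvg x v))
    (cvg_cst (pairing (power_map x) v)).
  move=> H; apply: (cvg_trans _ (H _ _ _)); apply: near_eq_cvg; near=> h.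
  have h0 : h != 0 by near: h; exact: nbhs_dnbhs_neq.
  transitivity (h^-1 * (`|h *: v + x| `^ p - `|x| `^ p)); last first.
    by rewrite /= scaler1 addr0.
  transitivity (pairing (h^-1 *: (power_map (h *: v + x) - power_map x) : lp q1)
    (h *: v + x) + pairing (power_map x) v) => //.
  rewrite -!power_map_norm (pairingZl pq h^-1) (pairingBl pq).
  rewrite (pairingDr pq (power_map x)) (pairingZr pq h).
  by field.
by split; [apply/cvg_ex; eexists; exact: H|exact: cvg_lim].
Unshelve. all: by end_near. Qed.

(** The derivative of y |-> |y|^(2-p) N y, with N = [power_map]. *)
Definition duality_derivative x v : lp q1 :=
  `|x| `^ (2 - p) *: ((p - 1) *: weight x v
    - ((p - 2) * pairing (power_map x) v / `|x| `^ p) *: power_map x).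

Lemma duality_derivativeE x v n :
  duality_derivative x v n = `|x| `^ (2 - p) * ((p - 1) * (`|x n| `^ (p - 2) * v n)
    - (p - 2) * pairing (power_map x) v / `|x| `^ p * signed_powR (p - 1) (x n)).
Proof. by rewrite -power_mapE. Qed.

(** Chain rule, writing |y|^(2-p) as (|y|^p)^((2-p)/p). *)
Lemma is_derive_norm_powR2 x v : x != 0 ->
  is_derive (0 : R) 1 (fun h => `|h *: v + x| `^ (2 - p))
    (- (`|x| `^ (2 - p) * ((p - 2) * pairing (power_map x) v / `|x| `^ p))).
Proof.
move=> x0; have nx0 : 0 < `|x| by rewrite normr_gt0.
have pp : p * ((2 - p) / p) = 2 - p by rewrite mulrCA mulfV ?mulr1// gt_eqF.
have D : is_derive (`|0 *: v + x| `^ p) 1 (fun t => t `^ ((2 - p) / p))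
    ((2 - p) / p * (`|0 *: v + x| `^ p) `^ ((2 - p) / p - 1)).
  by apply: is_derive1_powR; rewrite powR_gt0// scale0r add0r.
have := is_derive1_comp (g := fun h => `|h *: v + x| `^ p) (x := 0) D
  (is_derive_norm_powR x v).
rewrite scale0r add0r -powRrM mulrBr mulr1 powRB; last first.
  by rewrite (gt_eqF nx0) implybT.
rewrite pp.
rewrite (_ : _ \o _ = (fun h => `|h *: v + x| `^ (2 - p))); last first.
  by apply/funext => h; rewrite /= -powRrM pp.
congr (is_derive _ _ _ _).
have px0 : `|x| `^ p != 0 by rewrite gt_eqF// powR_gt0.
have p0 : p != 0 by rewrite gt_eqF.
by field; rewrite p0 px0.
Qed.

(** Product rule for c(h) N(x+hv) with c(h) = |x+hv|^(2-p). *)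
Lemma is_derive_normalized_duality x v : x != 0 ->
  is_derive x v (normalized_duality pq : lp p1 -> lp q1) (duality_derivative x v).
Proof.
move=> x0.
pose c h : R := `|h *: v + x| `^ (2 - p).
have [dc vc] := is_derive_norm_powR2 x v x0.
rewrite -/c in dc vc.
have cc : c h @[h --> (0:R)^'] --> `|x| `^ (2 - p).
  have /differentiable_continuous : differentiable c 0 by exact/derivable1_diffP.
  have -> : `|x| `^ (2 - p) = c 0 by rewrite /c scale0r add0r.
  by apply: cvg_trans; apply: cvg_app; exact: nbhs_dnbhs.
have dcc : h^-1 * (c h - c 0) @[h --> (0:R)^'] -->
    - (`|x| `^ (2 - p) * ((p - 2) * pairing (power_map x) v / `|x| `^ p)).
  rewrite -vc; apply: cvg_trans dc; apply: near_eq_cvg; apply: nearW => h.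
  by rewrite /= addr0 /GRing.scale/= mulr1.
have H : (fun h => h^-1 *: ((normalized_duality pq \o shift x) (h *: v)
    - normalized_duality pq x : lp q1)) @ (0:R)^' --> duality_derivative x v.
  rewrite (_ : duality_derivative x v = `|x| `^ (2 - p) *: ((p - 1) *: weight x v)
    + - (`|x| `^ (2 - p) * ((p - 2) * pairing (power_map x) v / `|x| `^ p))
      *: power_map x); last first.
    by rewrite /duality_derivative scalerBr scaleNr [X in _ - X]scalerA.
  have := cvgD (cvgZ cc (power_map_diff_quotient x v))
    (cvgZr_tmp (a := power_map x) dcc).
  move=> H; apply: (cvg_trans _ (H _ _ _)); apply: near_eq_cvg; apply: nearW => h.
  transitivity (c h *: (h^-1 *: (power_map (h *: v + x) - power_map x)) +
    (h^-1 * (c h - c 0)) *: power_map x) => //.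
  transitivity (h^-1 *: (normalized_duality pq (h *: v + x) -
    normalized_duality pq x : lp q1)); last by [].
  have c0 : `|x| `^ (2 - p) = c 0 by rewrite /c scale0r add0r.
  rewrite !normalized_duality_power_map c0 -/(c h).
  exact: scaler_diff_quotient.
by split; [apply/cvg_ex; eexists; exact: H|exact: cvg_lim].
Qed.

(** * Norm of the derivative *)

(** Hoelder's inequality for |x_n|^(p-2) and w_n^2 with the conjugate exponents
p/(p-2) and p/2. *)
Lemma weight_form_le x w : pairing (weight x w) w <= `|x| `^ (p - 2) * `|w| ^+ 2.
Proof.
have a0 : 0 < p / (p - 2) by rewrite divr_gt0// subr_gt0.
have b0 : 0 < p / 2 by rewrite divr_gt0.
have ab : (p / (p - 2))^-1 + (p / 2)^-1 = 1.
  have p0 : p != 0 by rewrite gt_eqF.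
  have p20 : p - 2 != 0 by rewrite gt_eqF// subr_gt0.
  by field; rewrite ?p0 ?p20.
have pa : (p - 2) * (p / (p - 2)) = p.
  by rewrite mulrCA mulfV ?mulr1// gt_eqF// subr_gt0.
have pb : 2 * (p / 2) = p by rewrite mulrCA mulfV ?mulr1.
have Ea : (fun n => `| `|x n| `^ (p - 2)| `^ (p / (p - 2))) =
    (fun n => `|x n| `^ p).
  by apply/funext => n; rewrite ger0_norm ?powR_ge0// -powRrM pa.
have Eb : (fun n => `|w n ^+ 2| `^ (p / 2)) = (fun n => `|w n| `^ p).
  by apply/funext => n; rewrite normrX -powR_mulrn// -powRrM pb.
have := hoelder_series _ _ (fun n => `|x n| `^ (p - 2)) (fun n => w n ^+ 2) a0 b0 ab.
rewrite Ea Eb => /(_ (is_cvg_series_lp p1 x) (is_cvg_series_lp p1 w))[_].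
rewrite -!lp_norm_powR -!powRrM.
have -> : p * (p / (p - 2))^-1 = p - 2 by rewrite invf_div mulrCA mulfV ?mulr1// gt_eqF.
have -> : p * (p / 2)^-1 = 2 by rewrite invf_div mulrCA mulfV ?mulr1// gt_eqF.
rewrite powR_mulrn//.
have -> // : pairing (weight x w) w =
    limn (series (fun n => `| `|x n| `^ (p - 2) * w n ^+ 2|)).
rewrite /pairing; congr (limn (series _)); apply/funext => n.
by rewrite weightE -mulrA -expr2 [RHS]ger0_norm// mulr_ge0 ?powR_ge0 ?sqr_ge0.
Qed.

Lemma weight_form_ge0 x w : 0 <= pairing (weight x w) w.
Proof.
apply: lim_series_ge0 => [n|]; last exact: is_cvg_pairing.
by rewrite weightE -mulrA mulr_ge0 ?powR_ge0// -expr2 sqr_ge0.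
Qed.

Lemma weight_form_linear x a u v w :
  pairing (weight x (a *: u + v)) w =
    a * pairing (weight x u) w + pairing (weight x v) w.
Proof. by rewrite weight_linear (pairingDl pq) (pairingZl pq). Qed.

(** The derivative is a positive semidefinite operator dominated by p - 1 times a
form of norm at most 1; by Cauchy-Schwarz such a symmetric operator has norm at
most p - 1. *)
Lemma norm_duality_derivative x v : x != 0 ->
  `|duality_derivative x v| <= (p - 1) * `|v|.
Proof.
move=> x0; pose B w u := pairing (weight x w) u.
have nx0 : 0 < `|x| by rewrite normr_gt0.
have Bl a u w z : B (a *: u + w) z = a * B u z + B w z.
  exact: weight_form_linear.
have BC u w : B u w = B w u by exact: pairing_weightC.
have B0 u : 0 <= B u u by exact: weight_form_ge0.
have CS := cauchy_schwarz B Bl BC B0.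
have BxE u : pairing (power_map x) u = B x u by rewrite /B weight_self.
have Bxx : `|x| `^ p = B x x by rewrite -power_map_norm BxE.
have Bxx0 : 0 < B x x by rewrite -Bxx powR_gt0.
(* |x|^(2-p) A is the bilinear form of the derivative *)
pose A w u := (p - 1) * B w u - (p - 2) * B x w * B x u / B x x.
have AE w u : pairing (duality_derivative x w) u = `|x| `^ (2 - p) * A w u.
  rewrite /duality_derivative (pairingZl pq) (pairingBl pq).
  rewrite (pairingZl pq (p - 1)) (pairingZl pq (_ / _)).
  by rewrite !BxE Bxx /A; congr (_ * (_ - _)); rewrite mulrAC.
have Al a u w z : A (a *: u + w) z = a * A u z + A w z.
  rewrite /A Bl (BC x (_ + _)) Bl (BC u x) (BC w x).
  by ring.
have AC u w : A u w = A w u.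
  by rewrite /A (BC u w); congr (_ - _ / _); rewrite mulrAC.
have CSx u : B x u ^+ 2 / B x x <= B u u.
  by rewrite ler_pdivrMr// mulrC CS.
have AuuE u : A u u = (p - 1) * B u u - (p - 2) * (B x u ^+ 2 / B x x).
  by rewrite /A expr2 !mulrA.
have Bq0 u : 0 <= B x u ^+ 2 / B x x by rewrite divr_ge0 ?sqr_ge0.
have A0 u : 0 <= A u u.
  rewrite AuuE subr_ge0 (le_trans (ler_wpM2l (ltW p2_gt0) (CSx u)))//.
  by rewrite ler_wpM2r// lerD2l lerN2 ler1n.
have Ale u : A u u <= (p - 1) * B u u.
  by rewrite AuuE lerBlDr lerDl mulr_ge0// ltW.
have cle u : `|x| `^ (2 - p) * A u u <= (p - 1) * `|u| ^+ 2.
  apply: (@le_trans _ _ (`|x| `^ (2 - p) * ((p - 1) * (`|x| `^ (p - 2) * `|u| ^+ 2)))).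
    rewrite ler_wpM2l ?powR_ge0// (le_trans (Ale _))// ler_wpM2l ?(ltW p1_gt0)//.
    exact: weight_form_le.
  rewrite mulrCA [X in _ * X]mulrA -powRD ?(gt_eqF nx0) ?implybT//.
  by rewrite -(opprB p 2) addNr powRr0 mul1r.
apply: (lp_norm_le_pairing pq) => [|u]; first by rewrite mulr_ge0// ltW.
rewrite AE -ler_sqr ?nnegrE ?mulr_ge0 ?(ltW p1_gt0)// real_normK ?num_real//.
rewrite exprMn.
apply: (le_trans (ler_wpM2l (sqr_ge0 _) (cauchy_schwarz A Al AC A0 v u))).
rewrite (expr2 (`|x| `^ (2 - p))) mulrACA.
apply: (le_trans (ler_pM _ _ (cle v) (cle u))); rewrite ?mulr_ge0 ?powR_ge0//.
by rewrite le_eqVlt; apply/orP; left; apply/eqP; ring.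
Qed.

Lemma duality_derivative_linear x a v w :
  duality_derivative x (a *: v + w) =
    a *: duality_derivative x v + duality_derivative x w.
Proof.
apply: lpP => n; rewrite /duality_derivative weight_linear.
rewrite (pairingDr pq (power_map x)) (pairingZr pq a).
rewrite !(lpD, lpN, lpZ).
by ring.
Qed.

End derivative.

(** * Representation by diagonal matrices *)

(** Multiplying by |x_n|^p removes the division in the ratio sequence, and
coordinates with x_n = 0 contribute 0 to both sides. *)
Lemma ratio_seq_mul {R : realType} (p : R) (x v : R^nat) n : 1 < p ->
  ratio_seq x v n * `|x n| `^ p = signed_powR (p - 1) (x n) * v n.
Proof.
move=> p1; have p0 : 0 < p by exact: lt_trans p1.
rewrite /ratio_seq; case: ifPn => [/eqP ->|xn].
  by rewrite mul0r /signed_powR sgr0 mulr0 mul0r.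
by rewrite -signed_powR_mul// mulrCA divfK.
Qed.

(** When x_n = 0 the right-hand side vanishes because p > 2. *)
Lemma signed_powR_ratio_seq {R : realType} (p : R) (x v : R^nat) n : 2 < p ->
  signed_powR (p - 1) (x n) * ratio_seq x v n = `|x n| `^ (p - 2) * v n.
Proof.
move=> p2; have p20 : 0 < p - 2 by rewrite subr_gt0.
rewrite /ratio_seq; case: ifPn => [/eqP ->|xn].
  by rewrite mulr0 normr0 powR0 ?gt_eqF// mul0r.
rewrite /signed_powR -(@mulr_powRB1 _ _ (p - 1)) ?subr_gt0 ?(lt_trans _ p2)// ?ltr1n//.
rewrite -addrA -opprD (mulrC `|x n|) -(mulrA _ `|x n|) (mulrC `|x n|) mulr_sg_norm.
by rewrite -mulrA; congr (_ * _); rewrite mulrCA mulfV ?mulr1.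
Qed.

Lemma lipschitz_continuous {R : realFieldType} {V W : normedModType R}
    (f : V -> W) (k : R) : 0 < k ->
  (forall x y, `|f x - f y| <= k * `|x - y|) -> continuous f.
Proof.
move=> k0 fk x; apply/cvgrPdist_lt => e e0.
near=> y; rewrite (le_lt_trans (fk _ _))// mulrC -ltr_pdivlMr//.
by near: y; apply: cvgr_dist_lt; [exact: cvg_id|exact: divr_gt0].
Unshelve. all: by end_near. Qed.

Theorem lemma4p2 (R : realType) (p q : R) (p2 : 2 < p)
    (pq : p^-1 + q^-1 = 1) (x : lp (exponent_ge1 p2)) (x0 : x != 0) :
  let l_p := lp (exponent_ge1 p2) in
  let l_q := lp (conjugate_exponent_ge1 p2 pq) in
  let J : l_p -> l_q := normalized_duality pq in
  let J'x : l_p -> l_q := fun v => 'D_v J x in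
  [/\ forall v : l_p,
        let lambda := ratio_seq x v in
        [/\ derivable J x v,
            cvgn (series (fun i => lambda i * `|x i| `^ p)),
            cvgn (series (fun i => `|x i| `^ p)) &
            J'x v = seq_mulmx (J x)
              ((p - 1) *: inf_diag_mx lambda
               - ((p - 2) * limn (series (fun i => lambda i * `|x i| `^ p))
                    / limn (series (fun i => `|x i| `^ p))) *: inf_diag_mx (fun=> 1))
            :> (nat -> R)],
      continuous J'x,
      linear J'x,
      exists k : R, k.-lipschitz J'x &
      forall u v : l_p, u != 0 -> v != 0 -> u != v ->
        `|J'x (v - u)| <= (p - 1 + (p - 2) * `|x| `^ q) * `|v - u|].
Proof.
move=> l_p l_q J J'x.
have p1 : 1 < p by rewrite (lt_trans _ p2)// ltr1n.
have J'E v : J'x v = duality_derivative p2 pq x v.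
  exact: (@derive_val _ _ _ _ _ _ _ (is_derive_normalized_duality p2 pq x v x0)).
have J'D u v : J'x (u - v) = J'x u - J'x v.
  by rewrite !J'E addrC -scaleN1r duality_derivative_linear scaleN1r addrC.
have J'le v : `|J'x v| <= (p - 1) * `|v|.
  by rewrite J'E; exact: norm_duality_derivative.
split.
- move=> v lambda.
  have lE : (fun i => lambda i * `|x i| `^ p) =
      (fun i => (power_map pq x : l_q) i * v i).
    by apply/funext => i; rewrite ratio_seq_mul// power_mapE.
  split.
  + exact: (@ex_derive _ _ _ _ _ _ _ (is_derive_normalized_duality p2 pq x v x0)).
  + by rewrite lE; exact: is_cvg_pairing.
  + exact: is_cvg_series_lp.
  + rewrite lE -lp_norm_powR J'E -/(pairing (power_map pq x : l_q) v).
    apply/funext => n.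
    set k := (p - 2) * _ / _.
    (* the bracketed matrix is itself diagonal *)
    rewrite (_ : _ - _ = inf_diag_mx (fun i => (p - 1) * lambda i - k)); last first.
      apply/funext => i; apply/funext => j.
      transitivity ((p - 1) * inf_diag_mx lambda i j
        - k * inf_diag_mx (fun=> 1) i j) => //.
      by rewrite /inf_diag_mx; case: ifP => _; rewrite ?mulr1// !mulr0 subr0.
    rewrite seq_mul_diag_mx normalized_dualityE.
    rewrite duality_derivativeE -/k.
    rewrite -(@signed_powR_ratio_seq _ _ _ v)// -/lambda -(opprB p 2) powRN.
    by ring.
- apply: (@lipschitz_continuous _ _ _ _ (p - 1)); first by rewrite subr_gt0.
  by move=> u v; rewrite -J'D.
- by move=> a u v; rewrite !J'E duality_derivative_linear.
- exists (p - 1) => -[u v] _ /=.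
  by rewrite -J'D.
(* p - 1 is already a Lipschitz constant; the added term is nonnegative *)
- move=> u v _ _ _; apply: le_trans (J'le _) _.
  by rewrite ler_wpM2r// lerDl mulr_ge0 ?powR_ge0// subr_ge0 ltW.
Qed.
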